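(* For all integers $n,k,d\ge1$, the group $\mathrm{RTM}(\mathbb{Z}^d,n,k)$ of reversible Turing machines is locally embeddable in finite groups (LEF), and thus sofic.
   Context: Let $\Sigma=\{0,\dots,n-1\}$, $Q=\{1,\dots,k\}$. Let $X_k=\{y\in\{0,1,\dots,k\}^{\mathbb{Z}^d} : y_{\vec u}\ne0\text{ and }y_{\vec v}\neq 0\implies \vec u=\vec v\}$ and $X_{n,k}=\Sigma^{\mathbb{Z}^d}\times X_k$. Given finite $F,F'\subset\mathbb{Z}^d$ and $f:\Sigma^F\times Q\to\Sigma^{F'}\times Q\times\mathbb{Z}^d$ (a local rule), the map $T_f:X_{n,k}\to X_{n,k}$ is defined by: $T_f(x,y)=(x,y)$ if $y$ is identically $0$; otherwise let $\vec v$ be the unique position with $q=y_{\vec v}\ne 0$, let $p\in\Sigma^F$ with $p_{\vec u}=x_{\vec v+\vec u}$, and $f(p,q)=(p',q',\vec e)$; then $T_f(x,y)=(\tilde x,\tilde y)$ with $\tilde x_{\vec t}=p'_{\vec t-\vec v}$ if $\vec t-\vec v\in F'$, $\tilde x_{\vec t}=x_{\vec t}$ otherwise, and $\tilde y_{\vec v+\vec e}=q'$, $\tilde y_{\vec t}=0$ for $\vec t\ne\vec v+\vec e$. Such maps are the $(d,n,k)$-Turing machines; one is reversible if it has a two-sided inverse that is a $(d,n,k)$-Turing machine. The reversible ones form the group $\mathrm{RTM}(\mathbb{Z}^d,n,k)$ under composition. A group $G$ is LEF if for every finite $M\subset G$ there are a finite group $H$ and a map $\phi:G\to H$ that is injective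 on $M$ and satisfies $\phi(gh)=\phi(g)\phi(h)$ for all $g,h\in M$. Sofic has its standard meaning. *)

(* Defs.v *)
From HB Require Import structures.
From mathcomp Require Import all_boot all_order all_algebra all_fingroup.
From mathcomp Require Import finmap boolp.

Set Implicit Arguments.
Unset Strict Implicit.
Unset Printing Implicit Defensive.

Import Order.TTheory GRing.Theory Num.Theory.
Local Open Scope fset_scope.
Local Open Scope ring_scope.

Section TuringMachines.
Variables d n k : nat.

Definition Zd := 'rV[int]_d.

Definition alphabet := 'I_n.

Definition state := {q : 'I_k.+1 | q != ord0}.

Record Xk := MkXk {
  head :> Zd -> 'I_k.+1;
  head_uniq : forall u v, head u != ord0 -> head v != ord0 -> u = v }.

Definition Xnk : Type := (Zd -> alphabet) * Xk.

Definition local_rule (F F' : {fset Zd}) : Type :=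
  {ffun F -> alphabet} * state -> {ffun F' -> alphabet} * state * Zd.

Definition window (x : Zd -> alphabet) (F : {fset Zd}) (v : Zd) :
  {ffun F -> alphabet} := [ffun u => x (v + val u)].

Definition overwrite (x : Zd -> alphabet) (F' : {fset Zd}) (v : Zd)
    (p' : {ffun F' -> alphabet}) : Zd -> alphabet :=
  fun t => if insub (t - v) is Some s then p' s else x t.

Fact single_head_uniq (v : Zd) (q : state) :
  let y t := if t == v then val q else ord0 in
  forall t u, y t != ord0 -> y u != ord0 -> t = u.
Proof. by move=> /= t u; case: (t =P v) => [->|_]; case: (u =P v) => [->|_];
   rewrite ?eqxx. Qed.

Definition single_head (v : Zd) (q : state) : Xk := MkXk (@single_head_uniq v q).

(* [cid] extracts the head position and state; they are unique by [head_uniq]. *)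
Definition turing_map (F F' : {fset Zd}) (f : local_rule F F') (c : Xnk) : Xnk :=
  match pselect (exists vq : Zd * state, c.2 vq.1 = val vq.2) with
  | left ex =>
      let: (v, q) := projT1 (cid ex) in
      let: (p', q', e) := f (window c.1 F v, q) in
      (overwrite c.1 v p', single_head (v + e) q')
  | right _ => c
  end.

Definition is_turing_machine (T : Xnk -> Xnk) : Prop :=
  exists (F F' : {fset Zd}) (f : local_rule F F'), T = turing_map f.

Definition reversible_turing_machine (T : Xnk -> Xnk) : Prop :=
  is_turing_machine T /\
  exists S, [/\ is_turing_machine S, cancel T S & cancel S T].

Record RTM := MkRTM {
  rtm_map :> Xnk -> Xnk;
  rtmP : reversible_turing_machine rtm_map }.

HB.instance Definition _ := gen_eqMixin RTM.
HB.instance Definition _ := gen_choiceMixin RTM.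

Lemma Xk_ext (y z : Xk) : y =1 z -> y = z.
Proof.
case: y z => [y hy] [z hz] /= /funext eyz.
by rewrite -eyz in hz *; congr MkXk; exact: Prop_irrelevance.
Qed.

Lemma Xk_cases (y : Xk) :
  (forall t, y t = ord0) \/ exists v q, y = single_head v q.
Proof.
have [[v yv]|/forallNP y0] := pselect (exists v, y v != ord0); last first.
  by left=> t; have /negP := y0 t; rewrite negbK => /eqP.
right; exists v, (exist (fun q => q != ord0) (y v) yv); apply: Xk_ext => t /=.
case: (t =P v) => [->//|ntv]; have [//|yt] := eqVneq (y t) ord0.
by case: ntv; exact: (head_uniq yt yv).
Qed.

Lemma turing_map_headless F F' (f : local_rule F F') x (y : Xk) :
  (forall t, y t = ord0) -> turing_map f (x, y) = (x, y).
Proof.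
rewrite /turing_map /= => y0; case: pselect => // -[[v [q q0]] /= yvq].
by exfalso; rewrite -yvq y0 eqxx in q0.
Qed.

Lemma turing_map_head F F' (f : local_rule F F') x v q :
  turing_map f (x, single_head v q) =
  let: (p', q', e) := f (window x F v, q) in
  (overwrite x v p', single_head (v + e) q').
Proof.
rewrite /turing_map /=; case: pselect => [ex|[]]; last first.
  by exists (v, q); rewrite /= eqxx.
case: (cid ex) => -[w r] /=; case: (w =P v) => [->|_] h; last first.
  by exfalso; case: r h => r r0 /= h; rewrite -h eqxx in r0.
by rewrite (val_inj (esym h)).
Qed.

Lemma overwriteE x (F : {fset Zd}) v (p : {ffun F -> alphabet}) t (tF : t - v \in F) :
  overwrite x v p t = p [` tF].
Proof.
rewrite /overwrite; case: insubP => [s _ st|]; last by rewrite tF.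
by congr (p _); apply: val_inj; rewrite st.
Qed.

Lemma overwrite_out x (F : {fset Zd}) v (p : {ffun F -> alphabet}) t :
  t - v \notin F -> overwrite x v p t = x t.
Proof. by move=> tF; rewrite /overwrite insubN. Qed.

Lemma is_turing_machine_id : is_turing_machine id.
Proof.
exists fset0, fset0, (fun pq => (pq, 0)); apply: funext => -[x y] /=.
have [y0|[v [q ->]]] := Xk_cases y; first by rewrite turing_map_headless.
rewrite turing_map_head addr0; congr (_, _); apply: funext => t.
by rewrite overwrite_out ?inE.
Qed.

Lemma overwrite_shift x x' (F : {fset Zd}) w v (p : {ffun F -> alphabet}) t :
  x t = x' (v + t) -> overwrite x w p t = overwrite x' (v + w) p (v + t).
Proof. by rewrite /overwrite => ->; rewrite [v + t]addrC addrKA. Qed.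

Section Composition.
Variables Ff Ff' Fg Fg' : {fset Zd}.
Variables (f : local_rule Ff Ff') (g : local_rule Fg Fg').

Definition comp_window : {fset Zd} :=
  [fset x in 0 :: enum_fset Fg ++ enum_fset Fg' ++
     [seq (g pq).2 + u | pq <- enum {: _}, u <- enum_fset (Ff `|` Ff')]].

Fact comp_window0 : 0 \in comp_window.
Proof. by rewrite !inE eqxx. Qed.

Definition comp_rule : local_rule comp_window comp_window := fun pq =>
  let: (p, q) := pq in
  let x0 t := if insub t is Some s then p s else p [` comp_window0] in
  let: (p1, q1, e1) := g (window x0 Fg 0, q) in
  let x1 := overwrite x0 0 p1 in
  let: (p2, q2, e2) := f (window x1 Ff e1, q1) in
  (window (overwrite x1 e1 p2) comp_window 0, q2, e1 + e2).

Lemma comp_ruleP : turing_map f \o turing_map g = turing_map comp_rule.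
Proof.
apply: funext => -[x y] /=.
have [y0|[v [q ->]]] := Xk_cases y; first by rewrite !turing_map_headless.
rewrite !turing_map_head /=.
set p := window x comp_window v.
set x0 := fun t => if insub t is Some s then _ else _.
have x0E t : t \in comp_window -> x0 t = x (v + t).
  by move=> tW; rewrite /x0 insubT /p ffunE.
have FgW t : t \in Fg -> t \in comp_window.
  by move=> tF; rewrite !(inE, mem_cat) tF orbT.
have Fg'W t : t \in Fg' -> t \in comp_window.
  by move=> tF; rewrite !(inE, mem_cat) tF !orbT.
have -> : window x0 Fg 0 = window x Fg v.
  by apply/ffunP => -[u uF]; rewrite !ffunE /= add0r x0E ?FgW.
case gE : (g _) => [[p1 q1] e1].
have FfW t : t \in Ff `|` Ff' -> e1 + t \in comp_window.
  move=> tF; rewrite !(inE, mem_cat); apply/orP; right; apply/orP; right.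
  apply/orP; right; apply/allpairsP; exists ((window x Fg v, q), t).
  by rewrite /= gE mem_enum; split.
rewrite turing_map_head.
set x1 := overwrite x0 0 p1; set x1' := overwrite x v p1.
have x1E t : t \in comp_window -> x1 t = x1' (v + t).
  by move=> tW; rewrite /x1 (@overwrite_shift _ x _ _ v) ?x0E // addr0.
have -> : window x1 Ff e1 = window x1' Ff (v + e1).
  apply/ffunP => -[u uF]; rewrite !ffunE /= x1E ?addrA //.
  by apply: FfW; rewrite inE uF.
case: (f _) => [[p2 q2] e2]; rewrite addrA; congr (_, _).
apply: funext => t; have [tW|tW] := boolP (t - v \in comp_window).
  rewrite (overwriteE _ _ tW) ffunE /= add0r (@overwrite_shift x1 x1' _ e1 v).
    by rewrite [v + (t - v)]addrC subrK.
  by rewrite x1E.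
rewrite (overwrite_out _ _ tW) overwrite_out; last first.
  apply: contra tW => tF; have := FfW (t - (v + e1)).
  have -> : e1 + (t - (v + e1)) = t - v.
    by rewrite opprD [t + _]addrA [LHS]addrC subrK.
  by rewrite inE tF orbT => ->.
by rewrite /x1' overwrite_out //; apply: contra tW; exact: Fg'W.
Qed.

End Composition.

Lemma is_turing_machine_comp T S :
  is_turing_machine T -> is_turing_machine S -> is_turing_machine (T \o S).
Proof.
move=> [F [F' [f ->]]] [G [G' [g ->]]].
by do 3!eexists; exact: comp_ruleP.
Qed.

Lemma RTM_ext (T S : RTM) : rtm_map T = rtm_map S -> T = S.
Proof.
case: T S => [T hT] [S hS] /= TS.
by rewrite -TS in hS *; congr MkRTM; exact: Prop_irrelevance.
Qed.

Fact RTM_one_subproof : reversible_turing_machine id.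
Proof. by split; [|exists id; split=> //]; exact: is_turing_machine_id. Qed.

Fact RTM_mul_subproof (T S : RTM) : reversible_turing_machine (T \o S).
Proof.
case: T S => [T [tT [T' [tT' TK KT]]]] [S [tS [S' [tS' SK KS]]]] /=.
split; first exact: is_turing_machine_comp.
by exists (S' \o T'); split; [exact: is_turing_machine_comp| |]; exact: can_comp.
Qed.

Definition RTM_inv_sig (T : RTM) := cid (rtmP T).2.

Fact RTM_inv_subproof (T : RTM) : reversible_turing_machine (projT1 (RTM_inv_sig T)).
Proof.
case: (RTM_inv_sig T) => S /= [tS TK SK]; split=> //.
by exists T; split=> //; exact: (rtmP T).1.
Qed.

Definition RTM_one : RTM := MkRTM RTM_one_subproof.
Definition RTM_mul (T S : RTM) : RTM := MkRTM (RTM_mul_subproof T S).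
Definition RTM_inv (T : RTM) : RTM := MkRTM (RTM_inv_subproof T).

Fact RTM_mulA : associative RTM_mul.
Proof. by move=> T S U; exact: RTM_ext. Qed.
Fact RTM_mul1 : left_id RTM_one RTM_mul.
Proof. by move=> T; exact: RTM_ext. Qed.
Fact RTM_mulr1 : right_id RTM_one RTM_mul.
Proof. by move=> T; exact: RTM_ext. Qed.
Fact RTM_mulV : left_inverse RTM_one RTM_inv RTM_mul.
Proof.
move=> T; apply/RTM_ext/funext => c /=.
by case: (RTM_inv_sig T) => S /= [_ TK _]; exact: TK.
Qed.
Fact RTM_mulrV : right_inverse RTM_one RTM_inv RTM_mul.
Proof.
move=> T; apply/RTM_ext/funext => c /=.
by case: (RTM_inv_sig T) => S /= [_ _ SK]; exact: SK.
Qed.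

HB.instance Definition _ :=
  isGroup.Build RTM RTM_mulA RTM_mul1 RTM_mulr1 RTM_mulV RTM_mulrV.

End TuringMachines.

Definition LEF (G : groupType) : Prop :=
  forall M : {fset G}, exists (H : finGroupType) (phi : G -> H),
    {in M &, injective phi} /\
    {in M &, forall g h, phi (g * h)%g = (phi g * phi h)%g}.

Definition hamming_dist (T : finType) (s t : {perm T}) : rat :=
  #|[set i | s i != t i]|%:R / #|T|%:R.

(* Taking eps rational loses nothing: both conditions weaken as eps grows.
   The product of {perm T} composes from left to right, which is immaterial here:
   inversion is a distance-preserving isomorphism onto the opposite group. *)
Definition sofic (G : groupType) : Prop :=
  forall (M : {fset G}) (eps : rat), 0 < eps ->
  exists (T : finType) (phi : G -> {perm T}), [/\ (0 < #|T|)%N,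
    {in M &, forall g h, hamming_dist (phi (g * h)%g) (phi g * phi h)%g <= eps} &
    {in M &, forall g h, g != h -> 1 - eps <= hamming_dist (phi g) (phi h)}].

(* Main.v *)
(** On a torus $(\mathbb{Z}/N)^d$ a Turing machine still acts, provided that $N$ is
    large compared with the windows of its local rule, and it acts on a finite set.
    For a finite set [M] of reversible machines choose a finite [E] containing the
    windows and the moves of all members of [M] and of their inverses.  As soon as
    the projection to the torus is injective on [E] and on [E + E], a machine cannot
    notice during two consecutive steps that it lives on a torus: hence the actions
    of members of [M] compose as the machines do, are bijective, and still
    distinguish the members of [M].  Soficity follows from LEF through the regular
    representation of the finite group. *)
Require Import Defs.
From mathcomp Require Import all_boot all_order all_algebra all_fingroup.
From mathcomp Require Import finmap boolp.

Set Implicit Arguments.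
Unset Strict Implicit.
Unset Printing Implicit Defensive.

Import Order.TTheory GRing.Theory Num.Theory.
Local Open Scope fset_scope.
Local Open Scope ring_scope.

(** * Hamming distances, and soficity of LEF groups *)

Lemma hamming_dist_refl (T : finType) (s : {perm T}) : hamming_dist s s = 0.
Proof.
rewrite /hamming_dist; have -> : [set i | s i != s i]%SET = finset.set0.
  by apply/setP => x; rewrite !inE eqxx.
by rewrite cards0 mul0r.
Qed.

Lemma hamming_dist_disjoint (T : finType) (s t : {perm T}) :
  (0 < #|T|)%N -> (forall i, s i != t i) -> hamming_dist s t = 1.
Proof.
move=> T_gt0 st; rewrite /hamming_dist; have -> : [set i | s i != t i]%SET = finset.setT.
  by apply/setP => x; rewrite !inE st.
by rewrite cardsT divff // pnatr_eq0 -lt0n.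
Qed.

(** Right translations by distinct elements of [H] disagree at every point, so the distances that
    occur are exactly 0 or 1, whatever [eps] is. *)
Lemma sofic_of_LEF (G : groupType) : LEF G -> sofic G.
Proof.
move=> lefG M eps eps_gt0; have [H [phi [phi_inj phiM]]] := lefG M.
have H_gt0 : (0 < #|H|)%N by apply/card_gt0P; exists 1%g.
exists H, (fun g => actperm 'R%act (phi g)); split=> // g h gM hM.
  have -> : actperm 'R%act (phi (g * h)%g) =
      (actperm 'R%act (phi g) * actperm 'R%act (phi h))%g.
    by rewrite phiM //; apply/permP => x; rewrite permM !actpermE /= mulgA.
  by rewrite hamming_dist_refl ltW.
move=> neq_gh; rewrite hamming_dist_disjoint ?lerBlDr ?lerDl ?ltW // => x.
by rewrite !actpermE /=; apply: contra neq_gh => /eqP/mulgI/phi_inj ->.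
Qed.

(** * Machines in coordinates centred at the head *)

Section Steps.
Variables d n k : nat.
Local Notation tape := (Zd d -> 'I_n).

(* The configuration is seen from the head, which sits at the origin before the
   step and at the returned vector after it. *)
Definition step := tape -> state k -> tape * state k * Zd d.

Definition id_step : step := fun x q => (x, q, 0).

(** [f] sees the tape recentred at [e1]; the final shift by [- e1] returns to the frame of the first
    step. *)
Definition comp_step (f g : step) : step := fun x q =>
  let: (x1, q1, e1) := g x q in
  let: (x2, q2, e2) := f (fun t => x1 (e1 + t)) q1 in
  (fun t => x2 (t - e1), q2, e1 + e2).

Definition run_step (f : step) (x : tape) (v : Zd d) (q : state k) : Xnk d n k :=
  let: (x', q', e) := f (fun t => x (v + t)) q in
  (fun t => x' (t - v), single_head (v + e) q').

(** Only configurations with a head are constrained: every Turing machine fixes the others. *)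
Definition step_for (T : Xnk d n k -> Xnk d n k) (f : step) : Prop :=
  forall x v q, T (x, single_head v q) = run_step f x v q.

(** One set bounds the move, the cells written and the cells read. Outputs are compared on [E]
    alone, since outside [E] they copy inputs that may differ. *)
Definition local_step (E : {fset Zd d}) (f : step) : Prop := forall x q,
  [/\ (f x q).2 \in E,
      forall t, t \notin E -> (f x q).1.1 t = x t &
      forall x', {in E, x =1 x'} ->
        (f x q).1.2 = (f x' q).1.2 /\ (f x q).2 = (f x' q).2 /\
        {in E, (f x q).1.1 =1 (f x' q).1.1}].

Lemma single_head_inj (v w : Zd d) (q r : state k) :
  single_head v q = single_head w r -> v = w /\ q = r.
Proof.
move=> /(congr1 (fun y : Xk d k => Defs.head y v)) /=; rewrite eqxx.
by case: eqP => [->|_] qr; [split=> //; exact: val_inj|case/eqP: (valP q)].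
Qed.

Lemma step_for_inj T f g : step_for T f -> step_for T g -> f = g.
Proof.
move=> Tf Tg; apply/funext => x; apply/funext => q.
have := Tf x 0 q; rewrite Tg /run_step.
rewrite (_ : (fun t => x (0 + t)) = x); last by apply/funext => t; rewrite add0r.
case: (f x q) (g x q) => [[x1 q1] e1] [[x2 q2] e2] fg.
have /single_head_inj[/addrI -> ->] := congr1 snd fg.
congr (_, _, _); apply/funext => t.
by have /(congr1 (fun y : tape => y t)) := congr1 fst fg; rewrite /= subr0.
Qed.

Lemma step_for_id : step_for id id_step.
Proof.
move=> x v q; rewrite /run_step /= addr0; congr (_, _).
by apply/funext => t; rewrite addrC subrK.
Qed.

Lemma step_for_comp T S f g :
  step_for T f -> step_for S g -> step_for (T \o S) (comp_step f g).
Proof.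
move=> Tf Sg x v q; rewrite /= Sg /run_step /comp_step.
case: (g _ q) => [[x1 q1] e1]; rewrite Tf /run_step.
rewrite (_ : (fun t => x1 (v + e1 + t - v)) = (fun t => x1 (e1 + t))); last first.
  by apply/funext => t; rewrite -(addrA v) [v + _]addrC addrK.
case: (f _ q1) => [[x2 q2] e2]; rewrite addrA; congr (_, _).
by apply/funext => t; rewrite opprD addrA.
Qed.

Lemma local_step_sub (E E' : {fset Zd d}) f : E `<=` E' -> local_step E f -> local_step E' f.
Proof.
move=> /fsubsetP sEE' fE x q; have [eE out agree] := fE x q; split.
- exact: sEE'.
- by move=> t tE'; apply: out; apply: contra tE'; exact: sEE'.
move=> x' xx'; have [|-> [-> xx'E]] := agree x'; first by move=> t /sEE'; exact: xx'.
do 2!split=> //; move=> t tE'; have [|tE] := boolP (t \in E); first exact: xx'E.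
by have [_ out' _] := fE x' q; rewrite out // out' // xx'.
Qed.

Lemma turing_machine_step T : is_turing_machine T ->
  exists f E, step_for T f /\ local_step E f.
Proof.
move=> [F [F' [f ->]]].
pose s : step := fun x q => let: (p', q', e) := f (window x F 0, q) in
  (overwrite x 0 p', q', e).
(* The rule has a finite domain, so its moves form a finite set. *)
exists s, (F `|` F' `|` [fset (f pq).2 | pq in {: {ffun F -> alphabet n} * state k}]).
split=> [x v q|x q].
  rewrite turing_map_head /run_step /s.
  rewrite (_ : window (fun t => x (v + t)) F 0 = window x F v); last first.
    by apply/ffunP => u; rewrite !ffunE add0r.
  case: (f _) => [[p' q'] e]; congr (_, _); apply/funext => t.
  by rewrite (@overwrite_shift d n _ x F' 0 v) // addr0 addrC subrK.
rewrite /s; split.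
- apply/fsetUP; right; apply/imfsetP; exists (window x F 0, q) => //=.
  by case: (f _) => [[]].
- move=> t; rewrite !inE !negb_or -andbA => /and3P[_ tF' _].
  by case: (f _) => [[p' q'] e] /=; rewrite overwrite_out ?subr0.
move=> x' xx'; rewrite (_ : window x' F 0 = window x F 0); last first.
  by apply/ffunP => u; rewrite !ffunE add0r xx' // !inE fsvalP.
case: (f _) => [[p' q'] e] /=; do 2!split=> //; move=> t /xx' tE.
by rewrite /overwrite tE.
Qed.

Lemma turing_machine_ext T S f : is_turing_machine T -> is_turing_machine S ->
  step_for T f -> step_for S f -> T = S.
Proof.
move=> [F [F' [r Tr]]] [K [K' [s Ss]]] Tf Sf; apply/funext => -[x y].
have [y0|[v [q ->]]] := Xk_cases y; first by rewrite Tr Ss !turing_map_headless.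
by rewrite Tf Sf.
Qed.

(** The choice is harmless: by [step_for_inj] the step of a machine is unique, which also makes
    [step_of] multiplicative. *)
Definition step_of (T : RTM d n k) : step :=
  projT1 (cid (turing_machine_step (rtmP T).1)).

Lemma step_ofP (T : RTM d n k) : step_for T (step_of T).
Proof. by rewrite /step_of; case: cid => f /= [E []]. Qed.

Lemma step_of_local (T : RTM d n k) : exists E, local_step E (step_of T).
Proof. by rewrite /step_of; case: cid => f /= [E []]; exists E. Qed.

Lemma step_of_inj : injective step_of.
Proof.
move=> T S TS; apply: RTM_ext; apply: (@turing_machine_ext _ _ (step_of T)).
- exact: (rtmP T).1.
- exact: (rtmP S).1.
- exact: step_ofP.
- by rewrite TS; exact: step_ofP.
Qed.

Lemma step_of1 : step_of 1%g = id_step.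
Proof. by apply: (step_for_inj (step_ofP 1%g)); exact: step_for_id. Qed.

Lemma step_ofM (T S : RTM d n k) : step_of (T * S)%g = comp_step (step_of T) (step_of S).
Proof.
apply: (step_for_inj (step_ofP (T * S)%g)).
exact: step_for_comp (step_ofP T) (step_ofP S).
Qed.

Lemma common_local_set (s : seq (RTM d n k)) :
  exists E, forall T, T \in s -> local_step E (step_of T).
Proof.
elim: s => [|T s [E sE]]; first by exists fset0.
have [E' TE'] := step_of_local T; exists (E' `|` E) => S.
rewrite inE => /predU1P[->|/sE]; last by apply: local_step_sub; exact: fsubsetUr.
by apply: local_step_sub TE'; exact: fsubsetUl.
Qed.

End Steps.

(** * The induced action on a finite torus *)

Section Torus.
Variables (d n k : nat) (V : finZmodType) (pi : {additive Zd d -> V}) (rep : V -> Zd d).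
Variable E : {fset Zd d}.
Hypothesis repK : cancel rep pi.
Hypothesis piK : {in E, cancel pi rep}.
Hypothesis piDK : {in E &, forall a b, rep (pi (a + b)) = a + b}.

Definition torus_conf : finType := ({ffun V -> 'I_n} * V * state k)%type.

(** The torus tape is unrolled periodically around the head; each cell of the result is read at the
    representative chosen by [rep]. *)
Definition torus_map (f : step d n k) (c : torus_conf) : torus_conf :=
  let: (x, v, q) := c in
  let: (x', q', e) := f (fun t => x (v + pi t)) q in
  ([ffun s => x' (rep (s - v))], v + pi e, q').

Lemma torus_map_id c : torus_map (@id_step d n k) c = c.
Proof.
case: c => [[x v] q] /=; rewrite raddf0 addr0; congr (_, _, _).
by apply/ffunP => s; rewrite ffunE repK addrC subrK.
Qed.

Lemma torus_map_comp f g c : local_step E f -> local_step E g ->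
  torus_map f (torus_map g c) = torus_map (comp_step f g) c.
Proof.
case: c => [[x v] q] fE gE; rewrite /torus_map /comp_step.
have := gE (fun t => x (v + pi t)) q.
case: (g _ q) => [[x1 q1] e1] /= [e1E _ _].
(* [Y] is the tape that the second step sees on the torus, [Z] the one it sees without wrapping.
   They agree on [E] because [e1 + t] is a sum of two elements of [E]. *)
set Y := fun t => [ffun s => _] _; set Z := fun t => x1 (e1 + t).
have YE t : Y t = x1 (rep (pi (e1 + t))).
  by rewrite /Y ffunE (raddfD pi) -(addrA v) [v + _]addrC addrK.
have [eE Yout YZ] := fE Y q1; have [_ Zout _] := fE Z q1.
have [|] := YZ Z; first by move=> t tE; rewrite YE piDK.
case: (f Y q1) (f Z q1) eE Yout Zout {YZ} => [[y2 q2] e2] [[z2 q2'] e2'] /=.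
move=> _ Yout Zout -> [-> yz]; rewrite (raddfD pi) addrA; congr (_, _, _).
apply/ffunP => s; rewrite !ffunE.
have pis : pi (e1 + rep (s - (v + pi e1))) = s - v.
  by rewrite (raddfD pi) repK opprD [s + _]addrA [LHS]addrC subrK.
(* Inside [E] the outputs agree and [piDK] matches the two positions. Outside, both steps copy: if
   [rep (s - v) - e1] were in [E], by [piK] it would be the representative assumed outside [E]. *)
have [uE|uE] := boolP (rep (s - (v + pi e1)) \in E).
  by rewrite yz // -pis piDK // [e1 + _]addrC addrK.
rewrite Yout // YE pis Zout /Z; first by rewrite (addrC e1) subrK.
apply: contra uE => wE; rewrite (_ : s - _ = pi (rep (s - v) - e1)) ?piK //.
by rewrite (raddfB pi) repK opprD addrA.
Qed.

(** Through [rep], the torus carries a copy of any tape on [E]. Since [pi] is injective on [E], the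
    action reveals the state, the move and the output on [E]; elsewhere both steps copy. *)
Lemma torus_map_inj f g : local_step E f -> local_step E g ->
  torus_map f =1 torus_map g -> f = g.
Proof.
move=> fE gE fg; apply/funext => x; apply/funext => q.
have := fg ([ffun s => x (rep s)], 0, q); rewrite /torus_map.
set X := fun t => [ffun s => _] _.
have XE : {in E, x =1 X} by move=> t tE; rewrite /X ffunE add0r piK.
have [feE fout /(_ _ XE)] := fE x q; have [geE gout /(_ _ XE)] := gE x q.
case: (f X q) (g X q) => [[fX qf] ef] [[gX qg] eg].
case: (f x q) feE fout => [[fx qf'] ef'] /= feE fout.
case: (g x q) geE gout => [[gx qg'] eg'] /= geE gout.
move=> [-> [eg_eq gxX]] [-> [ef_eq fxX]] []; rewrite !add0r -eg_eq -ef_eq.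
move=> /ffunP fgX /(can_in_inj piK) -> // ->; congr (_, _, _).
apply/funext => t; have [tE|tE] := boolP (t \in E); last by rewrite fout ?gout.
by have := fgX (pi t); rewrite !ffunE subr0 piK // fxX // gxX.
Qed.

End Torus.

(** * Choice of a large enough torus *)

Lemma intr_Zp_eq0 (N : nat) (a : int) : (`|a| < N.+2)%N -> a%:~R = 0 :> 'I_N.+2 -> a = 0.
Proof.
have nat_case (m : nat) : (m < N.+2)%N -> m%:R = 0 :> 'I_N.+2 -> m = 0%N.
  by move=> mN /(congr1 val); rewrite /= Zp_nat /= modn_small.
case: a => m mN; first by move=> /nat_case ->.
by rewrite NegzE mulrNz => /eqP; rewrite oppr_eq0 => /eqP/nat_case ->.
Qed.

Lemma torus_chart (d : nat) (D : {fset Zd d}) :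
  exists (V : finZmodType) (pi : {additive Zd d -> V}) (rep : V -> Zd d),
    cancel rep pi /\ {in D, cancel pi rep}.
Proof.
(* The modulus [N.+2] exceeds every coordinate difference within [D], so reduction is injective on
   [D]. *)
pose gap (p : D * D) : nat := \max_i absz ((val p.1 - val p.2)%R 0%R i).
pose N := \max_p gap p.
exists 'rV['I_N.+2]_d, (map_mx (intr : int -> 'I_N.+2)).
pose sec (s : 'rV['I_N.+2]_d) : Zd d := map_mx (fun i : 'I_N.+2 => Posz i) s.
pose pi : Zd d -> 'rV['I_N.+2]_d := map_mx (intr : int -> 'I_N.+2).
have secK : cancel sec pi.
  by move=> s; apply/rowP => i; rewrite !mxE -pmulrn natr_Zp.
have pi_inj : {in D &, injective pi}.
  move=> a b aD bD /rowP ab; apply/rowP => i; apply/eqP; rewrite -subr_eq0; apply/eqP.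
  apply: (@intr_Zp_eq0 N); last by have := ab i; rewrite !mxE intrB => ->; rewrite subrr.
  rewrite ltnS leqW //; apply: leq_trans (leq_bigmax (F := gap) ([` aD], [` bD])).
  have := leq_bigmax (F := fun j => absz ((a - b)%R 0%R j)) i.
  by rewrite !mxE.
(* A class that meets [D] is represented by its point of [D], any other class by its least
   nonnegative residues. *)
exists (fun s => oapp val (sec s) [pick u : D | pi (val u) == s]); split=> [s|a aD].
  by case: pickP => [u /eqP|_] /=; last exact: secK.
case: pickP => [u /eqP /= |/(_ [` aD])/=]; last by rewrite eqxx.
by move=> /pi_inj -> //; exact: fsvalP.
Qed.

(** * Local embedding into permutations of the torus configurations *)

Lemma RTM_LEF (d n k : nat) : LEF (RTM d n k).
Proof.
move=> M; have [E ME] := common_local_set (M ++ [seq g^-1 | g <- M])%g.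
have M_local g : g \in M -> local_step E (step_of g).
  by move=> gM; apply: ME; rewrite mem_cat gM.
have MV_local g : g \in M -> local_step E (step_of g^-1%g).
  by move=> gM; apply: ME; rewrite mem_cat map_f ?orbT.
have [V [pi [rep [repK DK]]]] := torus_chart (E `|` [fset a + b | a in E, b in E]).
have piK : {in E, cancel pi rep} by move=> a aE; rewrite DK // inE aE.
have piDK : {in E &, forall a b, rep (pi (a + b)) = a + b}.
  by move=> a b aE bE; rewrite DK // inE in_imfset2 ?orbT.
pose act g := @torus_map d n k V pi rep (step_of g).
have actM g h c : local_step E (step_of g) -> local_step E (step_of h) ->
    act (g * h)%g c = act g (act h c).
  by move=> gE hE; rewrite /act (torus_map_comp repK piK piDK) // step_ofM.
have act1 c : act 1%g c = c by rewrite /act step_of1 torus_map_id.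
have act_inj g : g \in M -> injective (act g).
  move=> gM; apply: (can_inj (g := act g^-1%g)) => c.
  rewrite -actM; [|exact: MV_local|exact: M_local].
  by rewrite mulVg; exact: act1.
(* The map must be total on the group; 1 is a default value for elements whose action on this torus
   is not injective. *)
pose perm_act g : {perm torus_conf n k V} :=
  if pselect (injective (act g)) is left inj then perm inj else 1%g.
have perm_actE g : injective (act g) -> perm_act g =1 act g.
  by move=> inj c; rewrite /perm_act; case: pselect => // inj'; rewrite permE.
(* [{perm _}] composes from left to right, [RTM] from right to left. *)
exists {perm torus_conf n k V}, (fun g => (perm_act g)^-1%g); split=> g h gM hM.
  move=> /invg_inj /permP gh; apply/step_of_inj/(torus_map_inj piK).
  - exact: M_local.
  - exact: M_local.
  - by move=> c; have := gh c; rewrite !perm_actE //; exact: act_inj.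
rewrite -invMg; congr (_^-1)%g; apply/permP => c.
have actMM c' : act (g * h)%g c' = act g (act h c').
  by apply: actM; exact: M_local.
rewrite permM !perm_actE; try exact: act_inj; first exact: actMM.
(* [g * h] need not lie in [M]; its action is injective as a composite of two injective ones. *)
move=> c1 c2; rewrite !actMM => e.
exact: (@act_inj h hM _ _ (@act_inj g gM _ _ e)).
Qed.

Local Close Scope ring_scope.
Local Close Scope fset_scope.

Theorem theorem6 (n k d : nat) (n_ge1 : 1 <= n) (k_ge1 : 1 <= k) (d_ge1 : 1 <= d) :
  LEF (RTM d n k) /\ sofic (RTM d n k).
Proof. by split; [|apply: sofic_of_LEF]; exact: RTM_LEF. Qed.
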